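(* There exists $N$ such that for all integers $n\ge N$ and all $t$ with $8n\le t\le \frac{n^{5/4}}{10^3}$, every deterministic finite automaton separating $\mathrm{EvenCycles}_{n,2}$ from $\mathrm{OddCycles}_{n,2}$ in time $t$ has more than $2^{\frac{n^5}{(10^3\cdot t)^4}}$ states.
   Context: Let $\Sigma=[n]\times[d]$ where $[m]=\{1,\dots,m\}$. A deterministic finite automaton over $\Sigma$ consists of a finite set $Q$ of states, an initial state $q_{start}\in Q$ and a transition function $\delta\colon Q\times\Sigma\to Q$, extended to words in the usual way. For disjoint $A,B\subseteq\Sigma^{\mathbb N}$, the automaton separates $A$ from $B$ in time $t$ if there is a state $q_{accept}$ such that for every infinite word $w=w_1w_2\ldots\in\Sigma^{\mathbb N}$: if $w\in A$ then $\delta(q_{start},w_1\ldots w_i)=q_{accept}$ for all $i\ge t$; if $w\in B$ then $\delta(q_{start},w_1\ldots w_i)\neq q_{accept}$ for all $i\ge 1$. A game graph with $n$ nodes and $d$ priorities is a pair $G=\langle E,\pi\rangle$ where $E\subseteq[n]^2$ is a set of directed edges (loops allowed, no parallel edges) such that every node $u\in[n]$ has at least one outgoing edge, and $\pi\colon E\to[d]$ assigns priorities. $G$ is even (resp. odd) if for every $k\ge1$ and every $v_1,\dots,v_k$ with $(v_1,v_2),\dots,(v_{k-1},v_k),(v_k,v_1)\in E$, the maximum of $\pi$ over these $k$ edges is even (resp. odd). $\mathrm{EvenCycles}_{n,d}$ (resp. $\mathrm{OddCycles}_{n,d}$) is the set of infinite words $(v_1,l_1)(v_2,l_2)\ldots\in\Sigma^{\mathbb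 N}$ for which there exists an even (resp. odd) game graph $G=\langle E,\pi\rangle$ with at most $n$ nodes and $d$ priorities such that $(v_i,v_{i+1})\in E$ and $\pi((v_i,v_{i+1}))=l_i$ for all $i\ge1$. *)

(* Defs.v *)
From Stdlib Require Import Reals.
From mathcomp Require Import all_boot.
Set Implicit Arguments.
Unset Strict Implicit.
Unset Printing Implicit Defensive.

(* Alphabet Sigma = [n] x [d]; the ordinal pair (v, l) stands for the
   paper's letter (v+1, l+1). *)
Definition Sigma (n d : nat) : Type := ('I_n * 'I_d)%type.

Record dfa (S : Type) := Dfa {
  dfa_state : finType;
  dfa_start : dfa_state;
  dfa_delta : dfa_state -> S -> dfa_state }.

(* Infinite words are maps nat -> S (w 0 is the paper's w_1). *)
Fixpoint run S (A : dfa S) (w : nat -> S) (i : nat) : dfa_state A :=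
  match i with
  | 0 => dfa_start A
  | i'.+1 => dfa_delta (run A w i') (w i')
  end.

Definition separates_in_time S (A : dfa S) (L1 L2 : (nat -> S) -> Prop)
  (t : nat) : Prop :=
  exists qacc : dfa_state A, forall w : nat -> S,
    (L1 w -> forall i, t <= i -> run A w i = qacc) /\
    (L2 w -> forall i, 1 <= i -> run A w i <> qacc).

(* Game graph with m nodes (nodes 0..m-1, standing for 1..m) and
   d priorities: E is the edge relation, pi u v the priority of edge (u,v). *)
Definition game_graph (m d : nat) (E : rel nat) (pi : nat -> nat -> nat) : Prop :=
  (forall u v, E u v -> u < m /\ v < m) /\
  (forall u, u < m -> exists v, E u v) /\
  (forall u v, E u v -> 1 <= pi u v <= d).

Definition cycle_max (pi : nat -> nat -> nat) (s : seq nat) : nat :=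
  \max_(e <- zip s (rot 1 s)) pi e.1 e.2.

Definition even_graph (E : rel nat) (pi : nat -> nat -> nat) : Prop :=
  forall s : seq nat, s != [::] -> cycle E s -> ~~ odd (cycle_max pi s).

Definition odd_graph (E : rel nat) (pi : nat -> nat -> nat) : Prop :=
  forall s : seq nat, s != [::] -> cycle E s -> odd (cycle_max pi s).

Definition word_in_graph n d (E : rel nat) (pi : nat -> nat -> nat)
  (w : nat -> Sigma n d) : Prop :=
  forall i, E (w i).1 (w i.+1).1 /\ pi (w i).1 (w i.+1).1 = (w i).2 + 1.

Definition EvenCycles (n d : nat) (w : nat -> Sigma n d) : Prop :=
  exists m E pi, m <= n /\ game_graph m d E pi /\ even_graph E pi /\
    word_in_graph E pi w.

Definition OddCycles (n d : nat) (w : nat -> Sigma n d) : Prop :=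
  exists m E pi, m <= n /\ game_graph m d E pi /\ odd_graph E pi /\
    word_in_graph E pi w.

(* Main.v *)
Require Import Defs.
From Stdlib Require Import Reals ZArith Lra.
From mathcomp Require Import all_boot all_order all_algebra.
From mathcomp Require Import zify ring lra.
Set Implicit Arguments.
Unset Strict Implicit.
Unset Printing Implicit Defensive.
Import Order.TTheory GRing.Theory Num.Theory.

(* An automaton with few states is fooled by an even and an odd word that reach
   the same state.  Both are cut into P phases of 1-edges, each closed by one
   2-edge leaving a node reserved for that phase.  The even word is given by one
   colouring c of the nodes with k colours: in every phase it visits all nodes
   of the current set G in the order (colour, node), so that its 1-edges never
   close a cycle.  The odd word visits in each phase a small set of nodes, which
   is then removed from G, possibly with many repetitions.

   The colouring is fixed only at the end: a set F of candidate colourings is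
   kept which all lead to the same state, and in each phase F shrinks to the
   most popular class of the states reached after each of the k colour classes,
   a loss of a factor |Q|^k.  Inside such a class the j-th colour class may be
   taken from any member of F, so the odd word may use the class j of a
   colouring c_j that depends on j.  Since F stays dense, isoperimetry in the
   Hamming cube makes some F-members c_j agree with the k cyclic shifts of a
   single random colouring up to few nodes, so that the class j of c_j is almost
   the same small set for all j. *)

(** * Isoperimetry in the Hamming cube, through exponential moments *)

Definition hamming (K : eqType) n (u c : n.-tuple K) : nat :=
  \sum_(i < n) (tnth u i != tnth c i).

Lemma hamming_cons (K : eqType) n a b (x y : n.-tuple K) :
  hamming (cons_tuple a x) (cons_tuple b y) = (a != b) + hamming x y.
Proof.
rewrite /hamming big_ord_recl !tnth0; congr (_ + _).
by apply: eq_bigr => i _; rewrite !tnthS.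
Qed.

Section TupleSums.
Variables (V : Type) (idx : V) (op : Monoid.com_law idx).

Lemma big_tupleS (K : finType) n (f : n.+1.-tuple K -> V) :
  \big[op/idx]_u f u = \big[op/idx]_a \big[op/idx]_x f (cons_tuple a x).
Proof.
rewrite pair_big /= (reindex (fun p : K * n.-tuple K => cons_tuple p.1 p.2)) //.
exists (fun u => (thead u, behead_tuple u)) => [[a x]|u] _ /=.
  by congr (_, _); apply: val_inj.
by rewrite [u in RHS]tuple_eta; apply: val_inj.
Qed.

End TupleSums.

Section Isoperimetry.
Local Open Scope ring_scope.
Variable K : finType.
Implicit Type beta : rat.

(* The maximum over r of (1 + beta - beta * r) * r. *)
Definition kappa beta := (1 + beta) ^+ 2 / (4 * beta).

(** With [r = p / q], this puts the convex function [1 / r] below its chord on [[1 / b, 1]]. *)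
Lemma chord_bound (b p q : rat) :
  0 < p -> p <= q -> q <= b * p -> q ^+ 2 <= p * ((1 + b) * q - b * p).
Proof.
move=> p0 pq qb; rewrite -subr_ge0.
have -> : p * ((1 + b) * q - b * p) - q ^+ 2 = (q - p) * (b * p - q) by ring.
by rewrite mulr_ge0 // subr_ge0.
Qed.

Definition slice n (F : {set n.+1.-tuple K}) a : {set n.-tuple K} :=
  [set x | cons_tuple a x \in F].

Lemma card_slices n (F : {set n.+1.-tuple K}) :
  #|F| = (\sum_a #|slice F a|)%N.
Proof.
rewrite -sum1_card big_mkcond big_tupleS; apply: eq_bigr => a _.
by rewrite -sum1_card [RHS]big_mkcond; apply: eq_bigr => x _; rewrite inE.
Qed.

(** Induction on [n], splitting off the first letter [a] of [u]: [cm] keeps [a] if slice [a] is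
    nearly as large as the largest slice, and otherwise moves to that slice at the cost of one
    factor [beta]. The chord makes both bounds linear in the slice size, so they sum over [a] to a
    bound in [#|F|]. *)
Lemma hamming_moment beta n (F : {set n.-tuple K}) : 1 <= beta -> F != set0 ->
  exists2 cm : n.-tuple K -> n.-tuple K, forall u, cm u \in F &
    (\sum_u beta ^+ hamming u (cm u)) * #|F|%:R
      <= kappa beta ^+ n * #|K|%:R ^+ (2 * n).
Proof.
move=> b1; have b0 : 0 < beta by apply: lt_le_trans b1.
have k0 : 0 < kappa beta.
  by rewrite divr_gt0 ?exprn_gt0 ?mulr_gt0 // addr_gt0.
elim: n F => [|n IH] F /set0Pn[f0 f0F].
  exists (fun _ => f0) => //; rewrite muln0 !expr0 mulr1.
  have h0 u : beta ^+ hamming u f0 = 1 by rewrite /hamming big_ord0.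
  rewrite (eq_bigr _ (fun u _ => h0 u)) sumr_const card_tuple expn0 mulr1n mul1r.
  by rewrite lern1 -(expn0 #|K|) -card_tuple max_card.
pose p a := #|slice F a|.
pose a1 := [arg max_(a > thead f0) p a].
have pmax a : (p a <= p a1)%N by rewrite /a1; case: arg_maxnP => // i _ /(_ a isT).
have p1 : (0 < p a1)%N.
  apply: leq_trans (pmax (thead f0)); rewrite card_gt0; apply/set0Pn.
  exists (behead_tuple f0); rewrite inE; suff -> : cons_tuple (thead f0) (behead_tuple f0) = f0 by [].
  by rewrite [in RHS](tuple_eta f0); apply: val_inj.
set C := kappa beta ^+ n * #|K|%:R ^+ (2 * n).
have C0 : 0 <= C by rewrite mulr_ge0 ?exprn_ge0 ?ler0n // ltW.
have step a : exists cm : n.-tuple K -> n.+1.-tuple K, (forall x, cm x \in F) /\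
   (\sum_x beta ^+ hamming (cons_tuple a x) (cm x)) * (p a1)%:R ^+ 2
      <= C * ((1 + beta) * (p a1)%:R - beta * (p a)%:R).
  have P1 : (0 : rat) < (p a1)%:R by rewrite ltr0n.
  have [near|far] := leP (p a1)%:R (beta * (p a)%:R).
    have pa : (0 < p a)%N.
      by rewrite lt0n; apply: contraTneq near => ->; rewrite mulr0 -ltNge.
    have [|cm cmF hcm] := IH (slice F a); first by rewrite -card_gt0.
    exists (fun x => cons_tuple a (cm x)); split=> [x|].
      by have := cmF x; rewrite inE.
    have -> : \sum_x beta ^+ hamming (cons_tuple a x) (cons_tuple a (cm x)) =
              \sum_x beta ^+ hamming x (cm x).
      by apply: eq_bigr => x _; rewrite hamming_cons eqxx.
    set s := \sum_x _ in hcm *; rewrite -/(p a) -/C in hcm.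
    have P0 : (0 : rat) < (p a)%:R by rewrite ltr0n.
    have s0 : 0 <= s by apply: sumr_ge0 => x _; rewrite exprn_ge0 // ltW.
    have := @chord_bound beta (p a)%:R (p a1)%:R P0 _ near.
    rewrite ler_nat => /(_ (pmax a)) /(ler_wpM2l s0) /le_trans -> //.
    rewrite mulrA ler_wpM2r //.
    have : (p a)%:R <= (p a1)%:R :> rat by rewrite ler_nat.
    by nra.
  have [|cm cmF hcm] := IH (slice F a1); first by rewrite -card_gt0.
  exists (fun x => cons_tuple a1 (cm x)); split=> [x|].
    by have := cmF x; rewrite inE.
  have : \sum_x beta ^+ hamming (cons_tuple a x) (cons_tuple a1 (cm x)) <=
         beta * \sum_x beta ^+ hamming x (cm x).
    rewrite mulr_sumr; apply: ler_sum => x _.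
    by rewrite hamming_cons exprD ler_wpM2r ?exprn_ge0 ?(ltW b0) //; case: (_ == _).
  have P12 : (0 : rat) <= (p a1)%:R ^+ 2 by rewrite exprn_ge0 // ltW.
  move=> /(ler_wpM2r P12) /le_trans -> //.
  have -> (s : rat) : beta * s * (p a1)%:R ^+ 2 = (beta * (p a1)%:R) * (s * (p a1)%:R) by ring.
  (* Here [beta * p a < p a1], so [beta * p a1] lies below the linear bound. *)
  apply: (@le_trans _ _ (beta * (p a1)%:R * C)).
    by rewrite ler_wpM2l // mulr_ge0 // ltW.
  by rewrite mulrC ler_wpM2l //; lra.
have [cms cmsP] := @fin_all_exists _ (fun=> _) _ step.
exists (fun u => cms (thead u) (behead_tuple u)) => [u|]; first by case: (cmsP (thead u)).
rewrite big_tupleS.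
have -> : \sum_a \sum_x beta ^+ hamming (cons_tuple a x)
     (cms (thead (cons_tuple a x)) (behead_tuple (cons_tuple a x))) =
   \sum_a \sum_x beta ^+ hamming (cons_tuple a x) (cms a x).
  apply: eq_bigr => a _; apply: eq_bigr => x _; rewrite theadE.
  by have -> : behead_tuple (cons_tuple a x) = x by apply: val_inj.
set s := \sum_a _.
have hs : s * (p a1)%:R ^+ 2 <= C * (#|K|%:R * ((1 + beta) * (p a1)%:R) - beta * #|F|%:R).
  rewrite mulr_suml; apply: le_trans (ler_sum _ (fun a _ => (cmsP a).2)) _.
  rewrite -mulr_sumr sumrB sumr_const -[_ *+ #|_|]mulr_natl -mulr_sumr card_slices natr_sum.
  exact: lexx.
have P1 : (0 : rat) < (p a1)%:R by rewrite ltr0n.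
have F0 : (0 : rat) <= #|F|%:R by rewrite ler0n.
rewrite -(ler_pM2r (exprn_gt0 2 P1)) mulrAC.
apply: le_trans (ler_wpM2r F0 hs) _.
rewrite -mulrA exprS mulnS exprD.
set f := #|F|%:R; set y := (p a1)%:R; set k := #|K|%:R.
have -> : kappa beta * kappa beta ^+ n * (k ^+ 2 * k ^+ (2 * n)) * y ^+ 2 =
   C * (kappa beta * k ^+ 2 * y ^+ 2) by rewrite /C -/k; ring.
rewrite ler_wpM2l //.
have bn : beta != 0 by rewrite gt_eqF.
rewrite -subr_ge0.
(* Completing the square: [kappa] is the maximum of this quadratic. *)
have -> : kappa beta * k ^+ 2 * y ^+ 2 - (k * ((1 + beta) * y) - beta * f) * f =
   (k * (1 + beta) * y - 2 * beta * f) ^+ 2 / (4 * beta) by rewrite /kappa; field.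
by rewrite divr_ge0 ?sqr_ge0 // mulr_ge0 // ltW.
Qed.

End Isoperimetry.

(** * From exponential moments to average distance *)

Section Average.
Local Open Scope ring_scope.

Lemma expr_ge_linear (e : rat) m : 0 <= e -> 1 + m%:R * e <= (1 + e) ^+ m.
Proof.
move=> e0; elim: m => [|m IH]; first by rewrite mul0r addr0.
have e1 : 0 <= 1 + e by rewrite addr_ge0.
rewrite exprSr; apply: le_trans (ler_wpM2r e1 IH).
by rewrite -natr1; have := ler0n rat m; nra.
Qed.

Lemma expr_le_inverse_linear (e : rat) m :
  0 <= e -> (1 + e) ^+ m * (1 - m%:R * e) <= 1.
Proof.
move=> e0; elim: m => [|m]; first by rewrite mul0r subr0 mulr1.
have e1 : 0 <= (1 + e) ^+ m by rewrite exprn_ge0 // addr_ge0.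
apply: le_trans; rewrite exprSr -mulrA ler_wpM2l // -natr1.
by have := ler0n rat m; nra.
Qed.

(* The exponential lies above its tangent line at D; this replaces Jensen. *)
Lemma expr_ge_tangent (e : rat) d D :
  0 <= e -> (1 + e) ^+ D * (1 + e * (d%:R - D%:R)) <= (1 + e) ^+ d.
Proof.
move=> e0; have [le_Dd|/ltnW le_dD] := leqP D d.
  rewrite -{2}(subnKC le_Dd) exprD ler_wpM2l ?exprn_ge0 ?addr_ge0 //.
  by rewrite -natrB // [e * _]mulrC expr_ge_linear.
rewrite -{1}(subnKC le_dD) exprD -mulrA ler_piMr ?exprn_ge0 ?addr_ge0 //.
rewrite -[_ - D%:R]opprB -natrB // mulrN [e * _]mulrC.
exact: expr_le_inverse_linear.
Qed.

(** The hypothesis bounds the average of [(1 + e) ^+ hamming] by [(1 + e) ^+ D]; the tangent line at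
    [D] turns this into an average distance of at most [D]. *)
Lemma average_hamming (K : finType) n (F : {set n.-tuple K}) (e : rat) D :
  0 < e -> F != set0 ->
  kappa (1 + e) ^+ n * #|K|%:R ^+ n <= (1 + e) ^+ D * #|F|%:R ->
  exists2 cm : n.-tuple K -> n.-tuple K, forall u, cm u \in F &
    (\sum_u hamming u (cm u) <= D * #|K| ^ n)%N.
Proof.
move=> e0 Fn0 hF; have F0 : (0 : rat) < #|F|%:R by rewrite ltr0n card_gt0.
have b0 : 0 < 1 + e by rewrite addr_gt0.
have [|cm cmF hcm] := @hamming_moment K (1 + e) n F _ Fn0.
  by rewrite lerDl ltW.
exists cm => //.
have h1 : \sum_u (1 + e) ^+ hamming u (cm u) <= (1 + e) ^+ D * #|K|%:R ^+ n.
  rewrite -(ler_pM2r F0); apply: le_trans hcm _.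
  rewrite mul2n -addnn exprD mulrA [leRHS]mulrAC.
  by rewrite ler_wpM2r // exprn_ge0 ?ler0n.
have h2 : (1 + e) ^+ D * \sum_u (1 + e * ((hamming u (cm u))%:R - D%:R)) <=
          (1 + e) ^+ D * #|K|%:R ^+ n.
  apply: le_trans h1; rewrite mulr_sumr.
  by apply: ler_sum => u _; apply: expr_ge_tangent; apply: ltW.
move: h2; rewrite ler_pM2l ?exprn_gt0 // big_split /= sumr_const card_tuple.
rewrite -natrX -mulr_sumr sumrB sumr_const card_tuple gerDl pmulr_rle0 //.
by rewrite subr_le0 -natr_sum -mulrnA ler_nat.
Qed.

End Average.

(** * Colour classes of cyclically shifted colourings *)

Section ColourShift.
Variables (k n D : nat) (F : {set n.-tuple 'I_k.+1}).

Definition shift (b : 'I_k.+1) (u : n.-tuple 'I_k.+1) : n.-tuple 'I_k.+1 :=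
  [tuple (tnth u i + b)%R | i < n].

Lemma shiftK b : cancel (shift b) (shift (- b)%R).
Proof. by move=> u; apply: eq_from_tnth => i; rewrite !tnth_mktuple addrK. Qed.

Lemma shift_bij b : bijective (shift b).
Proof.
exists (shift (- b)%R); first exact: shiftK.
by move=> u; have := shiftK (- b)%R u; rewrite opprK.
Qed.

Lemma sum_colour_classes (K : finType) (u : n.-tuple K) :
  \sum_a \sum_(v < n) (tnth u v == a) = n.
Proof.
rewrite exchange_big /= -[RHS]card_ord -sum1_card; apply: eq_bigr => v _.
rewrite (bigD1 (tnth u v)) //= eqxx big1 // => a /negbTE.
by rewrite eq_sym => ->.
Qed.

Lemma hamming_by_colour (w c : n.-tuple 'I_k.+1) :
  \sum_j \sum_(v < n) ((tnth c v == j) && (tnth w v != j)) = hamming w c.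
Proof.
rewrite exchange_big; apply: eq_bigr => v _ /=.
rewrite (bigD1 (tnth c v)) //= eqxx big1 ?addn0 // => a /negbTE.
by rewrite eq_sym => ->.
Qed.

(* Start from a random colouring u and shift it so that class a of u becomes
   class j: correcting every shift into F costs as many vertices outside class
   a, in total, as correcting one random colouring. *)
Lemma colour_classes_few_vertices cm : (forall u, cm u \in F) ->
  \sum_u hamming u (cm u) <= D * k.+1 ^ n ->
  exists2 cc : 'I_k.+1 -> n.-tuple 'I_k.+1, forall j, cc j \in F &
    k.+1 * #|[set v | [exists j, tnth (cc j) v == j]]| <= n + k.+1 * D.
Proof.
move=> cmF hD.
(* [N j w] counts the vertices that correcting [w] to [cm w] adds to class [j]; [X u a] adds all
   these to class [a] of [u], and so bounds the final union. *)
pose N j w := \sum_(v < n) ((tnth (cm w) v == j) && (tnth w v != j)).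
pose X u a := \sum_(v < n) (tnth u v == a) + \sum_j N j (shift (j - a)%R u).
have sumX : \sum_u \sum_a X u a <= k.+1 ^ n * (n + k.+1 * D).
  under eq_bigr do rewrite big_split sum_colour_classes /=.
  rewrite big_split sum_nat_const card_tuple card_ord /= mulnDr leq_add2l.
  rewrite exchange_big /=; under eq_bigr do rewrite exchange_big /=.
  (* Each shift permutes the colourings, so the sum over [u] does not see it. *)
  have e (a : 'I_k.+1) : \sum_j \sum_u N j (shift (j - a)%R u) = \sum_u hamming u (cm u).
    rewrite (eq_bigr (fun j => \sum_u N j u)) => [|j _].
      by rewrite exchange_big; apply: eq_bigr => u _; apply: hamming_by_colour.
    by rewrite [RHS](reindex (shift (j - a)%R)) //; apply/onW_bij/shift_bij.
  rewrite (eq_bigr _ (fun a _ => e a)) sum_nat_const card_ord.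
  by rewrite mulnCA leq_mul2l mulnC hD.
have /existsP[u /existsP[a hX]] :
    [exists u, [exists a, k.+1 * X u a <= n + k.+1 * D]].
  apply: contraLR sumX => noX; rewrite -ltnNge -(ltn_pmul2l (ltn0Sn k)).
  have big u a : n + k.+1 * D < k.+1 * X u a.
    rewrite ltnNge; apply: contra noX => h.
    by apply/existsP; exists u; apply/existsP; exists a.
  apply: (@leq_trans (\sum_(u : n.-tuple 'I_k.+1) \sum_(a < k.+1) (n + k.+1 * D).+1)).
    rewrite !sum_nat_const card_tuple card_ord mulnCA ltn_pmul2l ?expn_gt0 //.
    by rewrite ltn_pmul2l.
  rewrite big_distrr /=; apply: leq_sum => u _.
  by rewrite big_distrr /=; apply: leq_sum => a _.
exists (fun j => cm (shift (j - a)%R u)) => //.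
apply: leq_trans hX; rewrite leq_mul2l /=.
rewrite -sum1_card big_mkcond /X exchange_big -big_split /=; apply: leq_sum => v _.
rewrite inE; case: existsP => // -[j /eqP hj].
have [//|ne] := eqVneq (tnth u v) a.
(* Outside class [a] of [u] the shifted colour of [v] is not [j], so [v] is counted by [N j]. *)
rewrite add0n (bigD1 j) //= hj eqxx tnth_mktuple.
suff -> : (tnth u v + (j - a) != j)%R by [].
by apply: contra ne => /eqP h; rewrite -subr_eq0 -(inj_eq (addrI j)) addr0 addrCA h.
Qed.

End ColourShift.

(** * Density of a family of colourings against distance to it *)

Section Numeric.
Local Open Scope ring_scope.

(** With [e = 1 / M], [kappa (1 + e)] is at most [1 + e ^+ 2 / 4], so [M] coordinates together cost
    at most one factor [1 + e]; each factor 2 is absorbed by [(1 + e) ^+ M]. *)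
Lemma kappa_bound (M n c : nat) : (0 < M)%N ->
  kappa (1 + M%:R^-1) ^+ n * 2 ^+ c <= (1 + M%:R^-1 : rat) ^+ (n %/ M + 1 + M * c).
Proof.
move=> M0; set e : rat := M%:R^-1.
have e0 : 0 < e by rewrite invr_gt0 ltr0n.
have Me : M%:R * e = 1 by rewrite mulfV // pnatr_eq0 -lt0n.
have M1 : (1 : rat) <= M%:R by rewrite ler1n.
have b0 : 0 <= 1 + e by rewrite addr_ge0 // ltW.
have k1 : 1 <= kappa (1 + e).
  rewrite /kappa ler_pdivlMr; nra.
have k2 : kappa (1 + e) <= 1 + e * (e / 4).
  rewrite /kappa ler_pdivrMr; last by lra.
  have : 0 < e ^+ 3 by rewrite exprn_gt0.
  nra.
have k0 : 0 <= kappa (1 + e) by apply: le_trans k1.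
have kM : kappa (1 + e) ^+ M <= 1 + e.
  have f0 : 0 <= e * (e / 4) by nra.
  have h : (1 + e * (e / 4)) ^+ M * (1 - M%:R * (e * (e / 4))) <= 1.
    exact: expr_le_inverse_linear.
  have h2 : kappa (1 + e) ^+ M <= (1 + e * (e / 4)) ^+ M.
    by rewrite lerXn2r // nnegrE addr_ge0.
  apply: le_trans h2 _; set z := _ ^+ M in h *.
  have z0 : 0 <= z by rewrite exprn_ge0 // addr_ge0.
  rewrite mulrA Me mul1r in h.
  have e1 : e <= 1 by rewrite -Me; nra.
  nra.
rewrite exprD exprM ler_pM ?exprn_ge0 //.
  apply: (@le_trans _ _ (kappa (1 + e) ^+ (M * (n %/ M + 1)))).
    apply: ler_weXn2l => //; rewrite mulnDr muln1 {1}(divn_eq n M) mulnC leq_add2l.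
    by rewrite ltnW // ltn_mod.
  by rewrite exprM lerXn2r ?nnegrE // ?exprn_ge0.
rewrite lerXn2r ?nnegrE ?exprn_ge0 //.
by apply: le_trans (expr_ge_linear M (ltW e0)); rewrite Me.
Qed.

End Numeric.

Lemma dense_few_vertices k n M c (F : {set n.-tuple 'I_k.+1}) :
  0 < M -> k.+1 ^ n <= #|F| * 2 ^ c ->
  exists2 cc : 'I_k.+1 -> n.-tuple 'I_k.+1, forall j, cc j \in F &
    k.+1 * #|[set v | [exists j, tnth (cc j) v == j]]|
      <= n + k.+1 * (n %/ M + 1 + M * c).
Proof.
move=> M0 hF.
have Fn0 : F != set0.
  by rewrite -card_gt0; case: #|F| hF => //; rewrite mul0n leqn0 expn_eq0.
have e0 : (0 < M%:R^-1 :> rat)%R by rewrite invr_gt0 ltr0n.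
have [|cm cmF hcm] := @average_hamming _ n F _ (n %/ M + 1 + M * c) e0 Fn0; last first.
  by rewrite card_ord in hcm; apply: colour_classes_few_vertices cmF hcm.
rewrite card_ord; have F0 : (0 <= #|F|%:R :> rat)%R by rewrite ler0n.
apply: le_trans (ler_wpM2r F0 (kappa_bound n c M0)).
rewrite -mulrA; apply: ler_wpM2l.
  have b0 : (0 <= 1 + M%:R^-1 :> rat)%R by rewrite addr_ge0 // ltW.
  by rewrite exprn_ge0 // /kappa divr_ge0 // ?exprn_ge0 // ?mulr_ge0 // addr_ge0.
by rewrite [leRHS]mulrC -!natrX -natrM ler_nat.
Qed.

(** * Even and odd game graphs, and the words in them *)

Lemma path_all_zip (T : Type) (e : rel T) x p :
  path e x p = all (fun uv => e uv.1 uv.2) (zip (belast x p) p).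
Proof. by elim: p x => //= y p IH x; rewrite IH. Qed.

Lemma cycle_all_zip (T : Type) (e : rel T) s :
  cycle e s = all (fun uv => e uv.1 uv.2) (zip s (rot 1 s)).
Proof. by case: s => //= x p; rewrite rot1_cons path_all_zip belast_rcons. Qed.

Definition even_prio (rk : nat -> nat) u v := if rk u < rk v then 1 else 2.
Definition odd_prio (phi : nat -> nat) u v := if phi u == phi v then 1 else 2.

(** A rank cannot increase strictly all the way around a cycle, so some edge has priority 2. *)
Lemma even_graph_rank (E : rel nat) rk : even_graph E (even_prio rk).
Proof.
move=> s sn0 _; suff -> : cycle_max (even_prio rk) s = 2 by [].
apply/eqP; rewrite eqn_leq; apply/andP; split.
  by apply/bigmax_leqP_seq => -[u v] _ _; rewrite /even_prio; case: ifP.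
have : ~~ cycle [rel u v | rk u < rk v] s.
  case: s sn0 => // x s _; apply/negP.
  rewrite cycle_all2rel; last by move=> v u w /= /ltn_trans; apply.
  by move=> /allrelP/(_ x x (mem_head _ _) (mem_head _ _)) /=; rewrite ltnn.
rewrite cycle_all_zip => /allPn[[u v] uv /= /negbTE ltF].
by apply: leq_trans (leq_bigmax_seq _ uv isT); rewrite /even_prio /= ltF.
Qed.

(** Along a cycle [phi] never decreases, hence is constant, and every edge has priority 1. *)
Lemma odd_graph_monotone (E : rel nat) phi :
  (forall u v, E u v -> phi u <= phi v) -> odd_graph E (odd_prio phi).
Proof.
move=> Ephi s sn0 cycE; suff -> : cycle_max (odd_prio phi) s = 1 by [].
have : cycle [rel u v | phi u <= phi v] s by apply: sub_cycle cycE => u v /Ephi.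
rewrite cycle_all2rel => [/allrelP le_phi|v u w /= /leq_trans]; last exact.
have zip1 u v : (u, v) \in zip s (rot 1 s) -> odd_prio phi u v = 1.
  move=> uv; have us : u \in s.
    by rewrite -[s](@unzip1_zip _ _ _ (rot 1 s)) ?size_rot //; apply: map_f uv.
  have vs : v \in s.
    by rewrite -(mem_rot 1) -[rot 1 s](@unzip2_zip _ _ s) ?size_rot //; apply: map_f uv.
  by rewrite /odd_prio eqn_leq (le_phi u v us vs : phi u <= _) (le_phi v u vs us : phi v <= _).
apply/eqP; rewrite eqn_leq; apply/andP; split.
  by apply/bigmax_leqP_seq => -[u v] /zip1 -> .
case: s sn0 zip1 {cycE le_phi} => // x s _ zip1.
have [y hy] : exists y, (x, y) \in zip (x :: s) (rot 1 (x :: s)).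
  by rewrite rot1_cons; case: s {zip1} => [|y s]; [exists x|exists y]; rewrite /= mem_head.
by apply: leq_trans (leq_bigmax_seq _ hy isT); rewrite /= zip1.
Qed.

Section Words.
Variable n : nat.
Implicit Types (w : nat -> Sigma n 2) (a b d : Sigma n 2).

(** A letter carries the priority of the edge that leaves its node, minus one. *)
Definition linked (pi : nat -> nat -> nat) : rel (Sigma n 2) :=
  fun a b => pi a.1 b.1 == a.2 + 1.

Lemma EvenCycles_rank rk w :
  (forall i, linked (even_prio rk) (w i) (w i.+1)) -> EvenCycles w.
Proof.
move=> lw; exists n, [rel u v | (u < n) && (v < n)], (even_prio rk).
split; [exact: leqnn|split; [split; [|split]|split]].
- by move=> u v /andP.
- by move=> u un; exists u; rewrite /= un.
- by move=> u v _; rewrite /even_prio; case: ifP.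
- exact: even_graph_rank.
- by move=> i; split; [rewrite /= !ltn_ord|apply/eqP/lw].
Qed.

Lemma OddCycles_monotone (phi : nat -> nat) w :
  (forall i, phi (w i).1 <= phi (w i.+1).1) ->
  (forall i, linked (odd_prio phi) (w i) (w i.+1)) -> OddCycles w.
Proof.
move=> mw lw.
exists n, [rel u v | [&& u < n, v < n & phi u <= phi v]], (odd_prio phi).
split; [exact: leqnn|split; [split; [|split]|split]].
- by move=> u v /and3P[].
- by move=> u un; exists u; rewrite /= un /=.
- by move=> u v _; rewrite /odd_prio; case: ifP.
- by apply: odd_graph_monotone => u v /and3P[].
- by move=> i; split; [rewrite /= !ltn_ord mw|apply/eqP/lw].
Qed.

End Words.

(** An infinite word is encoded as [nth d s]: the finite word [s], then [d] forever. *)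
Lemma sorted_nth_default (T : Type) (e : rel T) d s :
  sorted e (rcons s d) -> e d d -> forall i, e (nth d s i) (nth d s i.+1).
Proof.
move=> srt dd i; have nthE j : nth d (rcons s d) j = nth d s j.
  by rewrite nth_rcons; case: ltngtP => // [/ltnW h|->]; rewrite nth_default.
have [lt_is|le_si] := ltnP i (size s).
  by rewrite -!nthE; apply: (sortedP d srt); rewrite size_rcons ltnS.
by rewrite !nth_default // ltnW.
Qed.

(** * Automaton runs and interchangeable blocks *)

Definition read S (A : dfa S) : dfa_state A -> seq S -> dfa_state A :=
  foldl (@dfa_delta S A).

Lemma run_nth S (A : dfa S) d (s : seq S) :
  run A (nth d s) (size s) = read (dfa_start A) s.
Proof.
have runE (w : nat -> S) i : run A w i = read (dfa_start A) (mkseq w i).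
  by elim: i => // i IH; rewrite mkseqS /read foldl_rcons -/(read _ _) -IH.
by rewrite runE mkseq_nth.
Qed.

Lemma pigeonhole (T Y : finType) (F : {set T}) (g : T -> Y) (y0 : Y) :
  exists y, #|F| <= #|[set x in F | g x == y]| * #|Y|.
Proof.
pose h y := #|[set x in F | g x == y]|.
exists [arg max_(y > y0) h y]; rewrite -/(h _) mulnC.
case: arg_maxnP => // y _ hmax.
rewrite -sum1_card (partition_big g predT) //= -sum_nat_const.
apply: leq_sum => z _; apply: leq_trans (hmax z isT).
by rewrite /h -sum1_card leq_eqVlt; apply/orP; left; apply/eqP/eq_bigl => x; rewrite inE.
Qed.

(* The objects in F' drive every state reached inside the phase to the same
   successor, so consecutive blocks may be taken from different objects. *)
Lemma interchangeable_class (T Q : finType) k (f : T -> 'I_k -> Q -> Q) q (F : {set T}) :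
  exists F' : {set T}, [/\ F' \subset F, #|F| <= #|F'| * #|Q| ^ k &
    forall (cc : 'I_k -> T) c, (forall j, cc j \in F') -> c \in F' ->
      foldl (fun q j => f (cc j) j q) q (enum 'I_k) =
      foldl (fun q j => f c j q) q (enum 'I_k)].
Proof.
pose st (cc : 'I_k -> T) m := foldl (fun q j => f (cc j) j q) q (take m (enum 'I_k)).
(* [g c] records the state after each of the [k] blocks; it takes at most [#|Q| ^ k] values. *)
pose g c := [ffun j : 'I_k => st (fun=> c) j.+1].
have [y hy] := pigeonhole F g [ffun=> q].
rewrite card_ffun card_ord in hy.
exists [set x in F | g x == y]; split => // [|cc c ccF cF].
  by apply/subsetP => x; rewrite inE => /andP[].
have szk : size (enum 'I_k) = k by rewrite size_enum_ord.
suff h m : m <= k -> st cc m = st (fun=> c) m.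
  by have := h k (leqnn k); rewrite /st take_oversize ?szk.
elim: m => [|m IH] mk; first by rewrite /st take0.
pose j := Ordinal mk.
have stS dd : st dd m.+1 = f (dd j) j (st dd m).
  rewrite /st (take_nth j) ?szk // foldl_rcons.
  by have -> : nth j (enum 'I_k) m = j by apply: val_inj; rewrite /= nth_enum_ord.
have gE d : d \in [set x in F | g x == y] -> st (fun=> d) m.+1 = y j.
  by rewrite inE => /andP[_ /eqP <-]; rewrite ffunE.
(* Before the first block every member is at [q]; later, at the state that [y] records for the
   previous block. *)
have agree d : d \in [set x in F | g x == y] -> st (fun=> d) m = st (fun=> c) m.
  case: m mk @j stS gE {IH} => [|m] mk j _ _ dF; first by rewrite /st !take0.
  have jE e : e \in [set x in F | g x == y] -> st (fun=> e) m.+1 = y (Ordinal (ltnW mk)).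
    by rewrite inE => /andP[_ /eqP <-]; rewrite ffunE.
  by rewrite !jE.
rewrite stS (IH (ltnW mk)) (gE c cF) -(gE _ (ccF j)) stS.
by rewrite agree.
Qed.

(** * The even and the odd word, phase by phase *)

Section Phases.
Variables (n k P : nat).
Implicit Types (G : {set 'I_n.+1}) (c : n.+1.-tuple 'I_k) (x : seq 'I_n.+1)
  (xs : seq (seq 'I_n.+1)).

(** [ord0] and [ord_max] stand for the priorities 1 and 2. *)
Definition letters x : seq (Sigma n.+1 2) := [seq (v, ord0) | v <- x].

Definition phase s x : seq (Sigma n.+1 2) := rcons (letters x) (inord s, ord_max).

Fixpoint word s xs : seq (Sigma n.+1 2) :=
  if xs is x :: xs' then phase s.+1 x ++ word s.+1 xs' else [::].

Definition block G c j := [seq v <- enum 'I_n.+1 | (v \in G) && (tnth c v == j)].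

Definition coloured G c := flatten [seq block G c j | j <- enum 'I_k].

Lemma word_rcons s xs x :
  word s (rcons xs x) = word s xs ++ phase (s + size xs).+1 x.
Proof.
elim: xs s => [|y xs IH] s /=; first by rewrite addn0 cats0.
by rewrite IH catA addSnnS.
Qed.

Lemma path_word (e : rel (Sigma n.+1 2)) s xs :
  (forall i, i < size xs ->
     path e (inord (s + i), ord_max) (phase (s + i).+1 (nth [::] xs i))) ->
  path e (inord s, ord_max) (word s xs) /\
  last (inord s, ord_max) (word s xs) = (inord (s + size xs), ord_max).
Proof.
elim: xs s => [|x xs IH] s h /=; first by rewrite addn0.
have [|hp hl] := IH s.+1.
  by move=> i ilt; rewrite addSnnS; apply: (h i.+1).
have h0 := h 0 isT; rewrite addn0 in h0.
by rewrite cat_path h0 last_cat /phase last_rcons hp hl addSnnS.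
Qed.

Lemma size_word s xs m :
  (forall x, x \in xs -> m <= 2 * (size x).+1) -> size xs * m <= 2 * size (word s xs).
Proof.
elim: xs s => [|x xs IH] s h //=.
rewrite size_cat size_rcons size_map mulSn mulnDr leq_add //.
  by apply: h; rewrite mem_head.
by apply: IH => y yxs; apply: h; rewrite inE yxs orbT.
Qed.

(* Nodes 0 to P+1 are reserved: node i >= 1 closes the i-th phase, node 0 heads
   the paths that justify the words, and the odd word ends by looping at P+1. *)
Definition rank c (v : nat) : nat :=
  if v <= P.+1 then k * n.+1 else tnth c (inord v) * n.+1 + v.

Lemma rank_coloured c (v : 'I_n.+1) : P.+1 < v -> rank c v = tnth c v * n.+1 + v.
Proof. by move=> Pv; rewrite /rank leqNgt Pv /= inord_val. Qed.

Lemma rank_lt c (v : 'I_n.+1) : P.+1 < v -> rank c v < k * n.+1.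
Proof.
move=> Pv; rewrite rank_coloured //.
have := ltn_ord v; have := ltn_ord (tnth c v); nia.
Qed.

Section Reserved.
Variable G : {set 'I_n.+1}.
Hypothesis G_reserved : forall v : 'I_n.+1, v \in G -> P.+1 < v.

(** On [G], [rank] writes (colour, node) in base [n.+1], which makes the order lexicographic. *)
Lemma pairwise_coloured c : pairwise [rel u v : 'I_n.+1 | rank c u < rank c v] (coloured G c).
Proof.
have memb j (v : 'I_n.+1) : v \in block G c j -> v \in G /\ tnth c v = j.
  by rewrite mem_filter => /andP[/andP[-> /eqP]].
have pw_ord m : pairwise [rel i j : 'I_m | i < j] (enum 'I_m).
  rewrite -(pairwise_map val ltn) val_enum_ord.
  by rewrite -sorted_pairwise ?iota_ltn_sorted //; apply: ltn_trans.
rewrite /coloured; elim: (enum 'I_k) (pw_ord k) => //= j js IH /andP[hj /IH hjs].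
rewrite pairwise_cat hjs andbT; apply/andP; split.
  apply/allrelP => u v /memb[uG cu] /flattenP[_ /mapP[i ijs ->] /memb[vG cv]] /=.
  rewrite !rank_coloured ?G_reserved // cu cv.
  have /= ji := allP hj i ijs; have := ltn_ord u; nia.
apply: (@sub_in_pairwise _ (mem (block G c j)) [rel u v : 'I_n.+1 | u < v]).
- move=> u v /memb[uG cu] /memb[vG cv] /= uv.
  by rewrite !rank_coloured ?G_reserved // cu cv ltn_add2l.
- exact/allP.
- by apply: pairwise_filter; apply: pw_ord.
Qed.

Lemma mem_coloured c v : (v \in coloured G c) = (v \in G).
Proof.
apply/flattenP/idP => [[_ /mapP[j _ ->]]|vG]; first by rewrite mem_filter => /andP[/andP[]].
by exists (block G c (tnth c v)); [apply: map_f; rewrite mem_enum|rewrite mem_filter vG eqxx mem_enum].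
Qed.

Lemma size_coloured c : size (coloured G c) = #|G|.
Proof.
rewrite -(eq_card (mem_coloured c)); apply/esym/card_uniqP.
by apply: pairwise_uniq (pairwise_coloured c) => v /=; rewrite ltnn.
Qed.

(** Reserved nodes share the top rank: edges from [G] into the closing node go up, and no edge out
    of a reserved node does. *)
Lemma path_even_phase c s : s <= P -> P.+1 < n.+1 ->
  path (linked (even_prio (rank c))) (inord s, ord_max) (phase s.+1 (coloured G c)).
Proof.
move=> sP Pn.
have top i : i <= P.+1 -> rank c (inord i : 'I_n.+1) = k * n.+1.
  by move=> iP; rewrite /rank inordK ?iP //; lia.
have leaves (b : Sigma n.+1 2) : linked (even_prio (rank c)) (inord s, ord_max) b.
  rewrite /linked /even_prio /= top; last by lia.
  rewrite ltnNge; have [/= bP|/rank_lt/ltnW->//] := leqP b.1 P.+1.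
  by rewrite /rank bP leqnn.
have : sorted [rel u v : 'I_n.+1 | rank c u < rank c v] (rcons (coloured G c) (inord s.+1)).
  apply: pairwise_sorted; rewrite pairwise_rcons pairwise_coloured andbT.
  by apply/allP => v; rewrite mem_coloured => /G_reserved/rank_lt /=; rewrite top.
rewrite /phase; case: (coloured G c) => [_|v x] /=; first by rewrite leaves.
rewrite leaves /=; elim: x v => [|u x IH] v /= /andP[vu hx].
  by rewrite /linked /even_prio /= vu.
by rewrite IH // andbT /linked /even_prio /= vu.
Qed.

End Reserved.

(** For a visited node, the number of its phase. The reserved node closing a phase has the same
    level, and only the 2-edge leaving it raises the level. *)
Definition level xs (v : nat) : nat :=
  if v <= P.+1 then v else (find (fun x => v \in map val x) xs).+1.

Definition odd_link xs : rel (Sigma n.+1 2) := fun a b =>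
  linked (odd_prio (level xs)) a b && (level xs a.1 <= level xs b.1).

Lemma path_odd_phase xs s x : s <= P -> P.+1 < n.+1 ->
  (forall v : 'I_n.+1, v \in x -> level xs v = s.+1) ->
  path (odd_link xs) (inord s, ord_max) (phase s.+1 x).
Proof.
move=> sP Pn hx.
have res i : i <= P.+1 -> level xs (inord i : 'I_n.+1) = i.
  by move=> iP; rewrite /level inordK ?iP //; lia.
suff gen a : (forall b : Sigma n.+1 2, level xs b.1 = s.+1 -> odd_link xs a b) ->
    path (odd_link xs) a (phase s.+1 x).
  apply: gen => b hb; rewrite /odd_link /linked /odd_prio /= hb res; last by lia.
  by rewrite (ltn_eqF (ltnSn s)) leqnSn.
elim: x a hx => [|v x IH] a hx ha /=; first by rewrite ha // res.
have hv : level xs v = s.+1 by apply: hx; rewrite mem_head.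
rewrite ha //=; apply: IH => [u ux|b hb]; first by apply: hx; rewrite inE ux orbT.
by rewrite /odd_link /linked /odd_prio /= hv hb eqxx leqnn.
Qed.

(** The phases are disjoint, so [find] stops at the only one containing [v]. *)
Lemma level_nth xs i (v : 'I_n.+1) : i < size xs ->
  pairwise [rel x y | ~~ has (mem x) y] xs ->
  P.+1 < v -> v \in nth [::] xs i -> level xs v = i.+1.
Proof.
move=> + + Pv; rewrite /level (leqNgt v) Pv /=.
elim: xs i => // x xs IH [|i] /= ilt /andP[hx hxs] vx.
  by rewrite mem_map ?vx //; apply: val_inj.
rewrite mem_map; last exact: val_inj.
rewrite ifF ?(IH i) //; apply: contraTF (allP hx _ (mem_nth [::] ilt)) => vx0.
by rewrite negbK; apply/hasP; exists v.
Qed.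

End Phases.

(** * The fooling pair of words *)

Lemma read_flatten S (A : dfa S) I (g : I -> seq S) q s :
  read q (flatten [seq g i | i <- s]) = foldl (fun q i => read (A := A) q (g i)) q s.
Proof. by elim: s q => //= i s IH q; rewrite {1}/read foldl_cat -IH. Qed.

Section Fooling.
Variables (n K P M b : nat) (A : dfa (Sigma n.+1 2)).
Let k := K.+1.
(** Over [P] phases the family loses a factor of at most [2 ^ (b * (k * P))]. *)
Let D := n.+1 %/ M + 1 + M * (b * (k * P)).
Hypothesis M_gt0 : 0 < M.
Hypothesis few_states : #|dfa_state A| <= 2 ^ b.
(** Divided by [k]: the reserved nodes and those removed in [P] phases are at most half of all
    nodes. *)
Hypothesis budget : 2 * (k * P.+2 + P * (n.+1 + k * D)) <= k * n.+1.

Definition fresh (ys : seq (seq 'I_n.+1)) : {set 'I_n.+1} :=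
  [set v : 'I_n.+1 | (P.+1 < v) && all (fun y => v \notin y) ys].

(** Induction on phases: [ys] and [Gs] record the odd and even phases so far, and all of [F] leads
    the even word to the state of the odd one. Each phase costs a density factor and some fresh
    nodes. *)
Lemma fooling_phases s : s <= P ->
  exists ys (Gs : seq {set 'I_n.+1}) (F : {set n.+1.-tuple 'I_k}),
  [/\ size ys = s /\ size Gs = s,
      k ^ n.+1 <= #|F| * #|dfa_state A| ^ (k * s),
      forall c, c \in F -> read (dfa_start A) (word 0 [seq coloured G c | G <- Gs]) =
                       read (dfa_start A) (word 0 ys),
      forall G, G \in Gs -> (forall v : 'I_n.+1, v \in G -> P.+1 < v) /\ n.+1 <= 2 * #|G|.+1 &
      [/\ forall y (v : 'I_n.+1), y \in ys -> v \in y -> P.+1 < v,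
          pairwise [rel x y | ~~ has (mem x) y] ys &
          k * n.+1 <= k * (#|fresh ys| + P.+2) + s * (n.+1 + k * D)]].
Proof.
elim: s => [|s IH] sP.
  exists [::], [::], setT; split=> //.
    by rewrite muln0 expn0 muln1 cardsT card_tuple card_ord.
  split=> //; rewrite mul0n addn0 leq_mul2l /=.
  (* At the start only the reserved nodes are not fresh. *)
  rewrite -[leqLHS]card_ord -(cardC (mem (fresh [::]))) leq_add2l.
  rewrite -(card_in_imset (f := fun v : 'I_n.+1 => inord v : 'I_P.+2)) => [|u v].
    by apply: leq_trans (max_card _) _; rewrite card_ord.
  rewrite !inE !andbT -!leqNgt => uP vP /(congr1 val) /=.
  by rewrite !inordK // => /val_inj.
have [ys [Gs [F [[sys sGs] hF st hGs [res disj room]]]]] := IH (ltnW sP).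
pose G := fresh ys; pose q := read (dfa_start A) (word 0 ys).
have G_res (v : 'I_n.+1) : v \in G -> P.+1 < v by rewrite inE => /andP[].
have [F' [F'F hF' mix]] :=
  interchangeable_class (fun c j q => read (A := A) q (letters (block G c j))) q F.
have dens : k ^ n.+1 <= #|F'| * #|dfa_state A| ^ (k * s.+1).
  apply: leq_trans hF _; rewrite mulnS expnD mulnA leq_mul2r.
  by rewrite hF' orbT.
have [|cc ccF' few] := @dense_few_vertices K n.+1 M (b * (k * P)) F' M_gt0.
  apply: leq_trans dens _; rewrite leq_mul2l; apply/orP; right.
  apply: (@leq_trans ((2 ^ b) ^ (k * s.+1))); first by rewrite leq_exp2r.
  by rewrite -expnM leq_pexp2l // !leq_mul2l sP !orbT.
(* Block [j] comes from its own colouring [cc j], so a node may occur in several blocks; [few]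
   bounds the distinct nodes. *)
pose y := flatten [seq block G (cc j) j | j <- enum 'I_k].
have y_fresh v : v \in y -> v \in G.
  by case/flattenP => _ /mapP[j _ ->]; rewrite mem_filter => /andP[/andP[]].
have lettersE (dd : 'I_k -> n.+1.-tuple 'I_k) :
    read q (letters (flatten [seq block G (dd j) j | j <- enum 'I_k])) =
    foldl (fun q j => read (A := A) q (letters (block G (dd j) j))) q (enum 'I_k).
  by rewrite /letters map_flatten -map_comp read_flatten.
exists (rcons ys y), (rcons Gs G), F'; split=> //.
- by rewrite !size_rcons sys sGs.
- move=> c cF'; rewrite map_rcons !word_rcons size_map sys sGs /read !foldl_cat.
  rewrite -!/(read _ _) st ?(subsetP F'F) // -/q /phase /read !foldl_rcons -!/(read _ _).
  congr (dfa_delta _ _); rewrite /coloured (lettersE (fun=> c)) lettersE.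
  by apply/esym/mix.
- move=> G'; rewrite mem_rcons inE => /orP[/eqP->|/hGs //]; split => //.
  have : s * (n.+1 + k * D) <= P * (n.+1 + k * D) by rewrite leq_mul2r ltnW ?orbT.
  move: room budget; rewrite -/G; move: (#|G|) (n.+1 + k * D) => g z.
  move=> h1 h2 h3; have kpos : 0 < k by [].
  have : k * n.+1 <= k * (2 * g) by lia.
  by rewrite leq_mul2l /=; lia.
split.
- move=> x v; rewrite mem_rcons inE => /orP[/eqP->|]; last exact: res.
  by move/y_fresh/G_res.
- rewrite pairwise_rcons disj andbT; apply/allP => x xys /=.
  apply/hasPn => v /y_fresh; rewrite inE => /andP[_ /allP/(_ x xys)].
  by [].
set U := [set v | _] in few.
have : #|G| <= #|fresh (rcons ys y)| + #|U|.
  apply: leq_trans (leq_card_setU _ _); apply/subset_leq_card/subsetP => v vG.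
  rewrite !inE; move: (vG); rewrite inE => /andP[-> hv] /=.
  rewrite all_rcons hv andbT; case: (boolP (v \in y)) => //= /flattenP[_ /mapP[j _ ->]].
  by rewrite mem_filter => /andP[/andP[_ cv] _]; apply/existsP; exists j.
have fewU : k * #|U| <= n.+1 + k * D by [].
move: room fewU; rewrite -/G mulSn; move: #|U| #|fresh _| #|G| (n.+1 + k * D).
move=> u f g z h1 h2 h3; have h4 : k * g <= k * (f + u) by rewrite leq_mul2l h3 orbT.
move: h1 h2 h4; rewrite !mulnDr; move: (s * z) (k * _) => sz; lia.
Qed.

(** Acceptance is forced only after [t] letters, hence [P] even phases of at least [n.+1 / 2]
    letters each; rejection already holds from the first letter on, so the odd word may be short. *)
Lemma separation_bound t : 2 * t <= P * n.+1 -> 0 < P ->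
  ~ separates_in_time A (@EvenCycles n.+1 2) (@OddCycles n.+1 2) t.
Proof.
move=> tP P_gt0 [qacc sep].
have Pn : P.+1 < n.+1.
  move: budget; rewrite ltnNge => h; apply/negP => h2.
  have : k * n.+1 <= k * P.+1 by rewrite leq_mul2l h2 orbT.
  by rewrite [k * P.+2]mulnS in h; have : 0 < k by []; lia.
have [ys [Gs [F [[sys sGs] hF st hGs [res disj _]]]]] := fooling_phases (leqnn P).
have [c cF] : exists c, c \in F.
  apply/set0Pn; rewrite -card_gt0; case: #|F| hF => //.
  by rewrite mul0n leqn0 expn_eq0.
pose we := word 0 [seq coloured G c | G <- Gs]; pose wo := word 0 ys.
(* The even word ends looping at [P] with priority 2, the odd word at [P.+1] with priority 1. *)
pose de : Sigma n.+1 2 := (inord P, ord_max).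
pose d_o : Sigma n.+1 2 := (inord P.+1, ord0).
have evenP : EvenCycles (nth de we).
  apply: (@EvenCycles_rank _ (rank P c)); apply: sorted_nth_default; last first.
    by rewrite /linked /even_prio /= ltnn.
  have [|hp hl] := @path_word n (linked (even_prio (rank P c))) 0 [seq coloured G c | G <- Gs].
    move=> i; rewrite size_map add0n sGs => iP.
    rewrite (nth_map set0) ?sGs //.
    have iG : i < size Gs by rewrite sGs.
    have [Gres _] := hGs _ (mem_nth set0 iG).
    by apply: path_even_phase => //; apply: ltnW.
  apply: (@path_sorted _ _ (inord 0, ord_max)); rewrite rcons_path hp hl size_map sGs.
  by rewrite /linked /even_prio /= add0n ltnn.
have odd_steps : forall i, odd_link P ys (nth d_o wo i) (nth d_o wo i.+1).
  apply: sorted_nth_default; last by rewrite /odd_link /linked /odd_prio /= eqxx leqnn.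
  have [|hp hl] := @path_word n (odd_link P ys) 0 ys.
    move=> i; rewrite add0n sys => iP; apply: path_odd_phase => //; first exact: ltnW.
    have iys : i < size ys by rewrite sys.
    by move=> v vi; apply: level_nth => //; apply: res vi; apply: mem_nth.
  apply: (@path_sorted _ _ (inord 0, ord_max)); rewrite rcons_path hp hl sys add0n.
  rewrite /odd_link /linked /odd_prio /level /= !inordK ?leqnn ?leqnSn //; last exact: ltnW.
  by rewrite (ltn_eqF (ltnSn P)) /=.
have oddP : OddCycles (nth d_o wo).
  apply: (@OddCycles_monotone _ (level P ys)) => i.
    by have /andP[] := odd_steps i.
  by have /andP[] := odd_steps i.
have size_we : t <= size we.
  rewrite -(leq_pmul2l (ltn0Sn 1)); apply: leq_trans tP _.
  rewrite -sGs -(size_map (fun G => coloured G c) Gs); apply: size_word => x /mapP[G /hGs[Gres hG] ->].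
  by rewrite (size_coloured Gres).
have size_wo : 1 <= size wo.
  rewrite /wo; case: ys sys {st res disj wo odd_steps oddP} => [eP|y ys _].
    by rewrite -eP in P_gt0.
  by rewrite /= size_cat size_rcons.
have [/(_ evenP (size we) size_we) acc _] := sep (nth de we).
have [_ /(_ oddP (size wo) size_wo) rej] := sep (nth d_o wo).
by apply: rej; rewrite run_nth -(st c cF) -/we -(run_nth A de).
Qed.

End Fooling.

(* q is always 1000; a variable keeps unary powers of 1000 from being computed. *)
Lemma no_small_separator q n t b (A : dfa (Sigma n 2)) :
  1000 <= q -> 0 < n -> 8 * n <= t -> 0 < b -> b * (q * t) ^ 4 <= 2 * n ^ 5 ->
  #|dfa_state A| <= 2 ^ b ->
  ~ separates_in_time A (@EvenCycles n 2) (@OddCycles n 2) t.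
Proof.
move=> hq; case: n A => // n A _ nt b0 hb hS.
(* Enough phases of half the nodes to reach length [t]. *)
pose P := (2 * t) %/ n.+1 + 1.
have P0 : 0 < P by rewrite /P addn1.
have P1 : 2 * t <= P * n.+1.
  by rewrite /P addn1 ltnW // ltn_ceil.
have P2 : P * n.+1 <= 3 * t.
  rewrite /P mulnDl mul1n; have := leq_trunc_div (2 * t) n.+1; lia.
have b4 : 500 * (b * P ^ 4) <= n.+1.
  have q4 : 500 * 162 <= q ^ 4.
    rewrite (expnS q 3) leq_mul //; first by apply: leq_trans hq.
    by apply: (@leq_trans (q ^ 1)); [apply: leq_trans hq|rewrite leq_pexp2l //; apply: leq_trans hq].
  have h : (P * n.+1) ^ 4 <= (3 * t) ^ 4 by rewrite leq_exp2r.
  rewrite !expnMn in h hb; move: h hb q4; rewrite (_ : 3 ^ 4 = 81) // (expnS n.+1 4).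
  have : 0 < n.+1 ^ 4 by rewrite expn_gt0.
  move: (P ^ 4) (n.+1 ^ 4) (t ^ 4) (q ^ 4) => p n4 t4 m n0 h hb q4.
  have h1 : b * (p * n4) <= b * (81 * t4) by rewrite leq_mul2l h orbT.
  have h2 : b * t4 * (500 * 162) <= b * t4 * m by rewrite leq_mul2l q4 orbT.
  by rewrite -(leq_pmul2r n0); lia.
have P4 : P <= b * P ^ 4.
  by rewrite -[leqLHS]mul1n leq_mul // -[leqLHS]expn1 leq_pexp2l.
(* With [k = 8 * P] and [M = 16 * P], the main losses over [P] phases are at most [n.+1] times 1/8,
   1/16 and 128/500, together below one half. *)
apply: (@separation_bound n (8 * P).-1 P (16 * P) b A) => //; first by rewrite muln_gt0.
rewrite prednK ?muln_gt0 //.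
have := leq_trunc_div n.+1 (16 * P); move: (_ %/ _) => d hd.
have -> : P * (n.+1 + 8 * P * (d + 1 + 16 * P * (b * (8 * P * P)))) =
  P * (n.+1 + 8 * P * d + 8 * P + 1024 * (b * P ^ 4)).
  by congr (P * _); rewrite !expnS expn0; ring.
move: (b * P ^ 4) b4 P4 hd => w b4 P4 hd.
have : 2 * (8 * P.+2 + (n.+1 + 8 * P * d + 8 * P + 1024 * w)) <= 8 * n.+1 by lia.
move/(leq_mul (leqnn P)); rewrite -!mulnA; lia.
Qed.

(** * Real exponents and the final bound *)

Section RealBounds.
Local Open Scope R_scope.

Lemma INR_expn m i : INR (m ^ i)%N = INR m ^ i.
Proof. by elim: i => // i IH; rewrite expnS mult_INR IH. Qed.

(** Makes the exponent of the theorem at least 1, so that rounding it up at most doubles it. *)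
Lemma fourth_power_bound n t : (0 < n)%N ->
  INR t <= Rpower (INR n) (5 / 4) / 1000 -> (1000 * INR t) ^ 4 <= INR n ^ 5.
Proof.
move=> n0 ht; have n0' : 0 < INR n by apply: lt_0_INR; apply/ssrnat.ltP.
have -> : INR n ^ 5 = Rpower (INR n) (5 / 4) ^ 4.
  rewrite -(Rpower_pow 4); last exact: exp_pos.
  rewrite Rpower_mult -Rpower_pow //.
  by congr Rpower; rewrite /=; Lra.lra.
apply: pow_incr; have := pos_INR t; Lra.lra.
Qed.

Lemma natural_exponent (S : nat) (x : R) : 1 <= x -> INR S <= Rpower 2 x ->
  exists b : nat, [/\ (0 < b)%N, INR b <= 2 * x & (S <= 2 ^ b)%N].
Proof.
move=> x1 hS; have [up_gt up_le] := archimed x.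
have up0 : Z.le Z0 (up x) by apply: le_IZR; Lra.lra.
have bE : INR (Z.to_nat (up x)) = IZR (up x) by rewrite INR_IZR_INZ Z2Nat.id.
exists (Z.to_nat (up x)); split.
- by apply/ssrnat.ltP/INR_lt; rewrite bE /=; Lra.lra.
- by rewrite bE; Lra.lra.
apply/ssrnat.leP/INR_le; rewrite INR_expn.
apply: Rle_trans hS _; rewrite (_ : INR 2 = 2) // -Rpower_pow; last by Lra.lra.
by apply: Rle_Rpower; rewrite ?bE; Lra.lra.
Qed.

End RealBounds.

Theorem theorem5 :
  exists N : nat, forall n t : nat,
    (N <= n)%N -> (8 * n <= t)%N ->
    Rle (INR t) (Rdiv (Rpower (INR n) (Rdiv 5 4)) 1000) ->
    forall A : dfa (Sigma n 2),
      separates_in_time A (@EvenCycles n 2) (@OddCycles n 2) t ->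
      Rlt (Rpower 2 (Rdiv (pow (INR n) 5) (pow (Rmult 1000 (INR t)) 4))) (INR #|dfa_state A|).
Proof.
(* The two bounds on [t] already force a positive [n] to be large, so [N = 1] serves. *)
exists 1%N => n t n0 nt ht A sepA; apply: Rnot_le_lt => few.
have tn := fourth_power_bound n0 ht.
have t_gt0 : Rlt 0 (INR t).
  by apply: lt_0_INR; apply/ssrnat.ltP; apply: leq_trans nt; rewrite muln_gt0.
have [q q1000 qE] : exists2 q, (1000 <= q)%N & INR q = IZR 1000.
  by exists 1000; rewrite ?leqnn // INR_IZR_INZ.
move: tn few; rewrite -qE -mult_INR -!INR_expn => tn few.
have qt_gt0 : Rlt 0 (INR ((q * t) ^ 4)).
  apply: lt_0_INR; apply/ssrnat.ltP; rewrite expn_gt0 muln_gt0 (leq_trans _ q1000) //= orbF.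
  by apply/ssrnat.ltP/INR_lt.
have qt_neq0 := Rgt_not_eq _ _ qt_gt0.
have [|b [b0 hb hS]] := natural_exponent _ few.
  apply: (Rmult_le_reg_r _ _ _ qt_gt0).
  by rewrite Rmult_1_l /Rdiv Rmult_assoc Rinv_l ?Rmult_1_r //; Lra.lra.
apply: (@no_small_separator q n t b A q1000 n0 nt b0 _ hS sepA).
apply/ssrnat.leP/INR_le; rewrite (mult_INR b) (mult_INR 2).
apply: (Rle_trans _ _ _ (Rmult_le_compat_r _ _ _ (Rlt_le _ _ qt_gt0) hb)).
right; rewrite /Rdiv !Rmult_assoc Rinv_l ?Rmult_1_r //; Lra.lra.
Qed.
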